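(* The following equations are derivable from the equations $\mathit{Md}$ of meadows (equivalently, hold for all elements $x,y$ of every meadow): (1) $(x\cdot y)^{-1}=x^{-1}\cdot y^{-1}$; (2) $(-x)^{-1}=-(x^{-1})$.
   Context: $\Sigma$ is the signature with constants $0,1$, binary operations $+,\cdot$, and unary operations $-$ and ${}^{-1}$, all total. $\mathit{Md}$ consists of the equations of commutative rings with unit (the trivial ring is allowed) together with $(x^{-1})^{-1}=x$ and $x\cdot(x\cdot x^{-1})=x$. A meadow is a $\Sigma$-algebra satisfying $\mathit{Md}$. *)

(* Defs.v *)
From Stdlib Require Import List.
Import ListNotations.

Set Implicit Arguments.
Unset Strict Implicit.

Inductive term : Type :=
| Var (n : nat)
| Zero
| One
| Add (s t : term)
| Mul (s t : term)
| Opp (s : term)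
| Inv (s : term).

Declare Scope term_scope.
Delimit Scope term_scope with term.
Bind Scope term_scope with term.

Notation "0" := Zero : term_scope.
Notation "1" := One : term_scope.
Infix "+" := Add : term_scope.
Infix "*" := Mul : term_scope.
Notation "- s" := (Opp s) : term_scope.
Notation "s ^-1" := (Inv s) (at level 2, left associativity, format "s ^-1")
  : term_scope.

Record equation : Type := Equation { lhs : term; rhs : term }.

Notation "s == t" := (Equation s%term t%term) (at level 70, no associativity).

Definition vx : term := Var 0.
Definition vy : term := Var 1.
Definition vz : term := Var 2.

(* Commutative rings with unit; 0 <> 1 is not required. *)
Definition CR : list equation :=
  [ (vx + vy) + vz == vx + (vy + vz);
    vx + vy == vy + vx;
    vx + 0 == vx;
    vx + - vx == 0;
    (vx * vy) * vz == vx * (vy * vz);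
    vx * vy == vy * vx;
    vx * 1 == vx;
    vx * (vy + vz) == vx * vy + vx * vz ].

Definition Md : list equation :=
  CR ++
  [ (vx^-1)^-1 == vx;
    vx * (vx * vx^-1) == vx ].

Fixpoint subst (sigma : nat -> term) (t : term) : term :=
  match t with
  | Var n => sigma n
  | Zero => Zero
  | One => One
  | Add s t => Add (subst sigma s) (subst sigma t)
  | Mul s t => Mul (subst sigma s) (subst sigma t)
  | Opp s => Opp (subst sigma s)
  | Inv s => Inv (subst sigma s)
  end.

(* Equational logic: the least congruence on terms containing all
   substitution instances of the equations of E. *)
Inductive derivable (E : list equation) : equation -> Prop :=
| D_ax e sigma : In e E ->
    derivable E (subst sigma (lhs e) == subst sigma (rhs e))
| D_refl t : derivable E (t == t)
| D_sym s t : derivable E (s == t) -> derivable E (t == s)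
| D_trans s t u :
    derivable E (s == t) -> derivable E (t == u) -> derivable E (s == u)
| D_add s s' t t' :
    derivable E (s == s') -> derivable E (t == t') ->
    derivable E (s + t == s' + t')
| D_mul s s' t t' :
    derivable E (s == s') -> derivable E (t == t') ->
    derivable E (s * t == s' * t')
| D_opp s s' : derivable E (s == s') -> derivable E (- s == - s')
| D_inv s s' : derivable E (s == s') -> derivable E (s^-1 == s'^-1).

Record algebra : Type := Algebra {
  carrier :> Type;
  zero : carrier;
  one : carrier;
  add : carrier -> carrier -> carrier;
  mul : carrier -> carrier -> carrier;
  opp : carrier -> carrier;
  inv : carrier -> carrier }.

Fixpoint eval (A : algebra) (v : nat -> A) (t : term) : A :=
  match t with
  | Var n => v n
  | Zero => zero A
  | One => one A
  | Add s t => add (eval v s) (eval v t)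
  | Mul s t => mul (eval v s) (eval v t)
  | Opp s => opp (eval v s)
  | Inv s => inv (eval v s)
  end.

Definition satisfies (A : algebra) (e : equation) : Prop :=
  forall v : nat -> A, eval v (lhs e) = eval v (rhs e).

Definition meadow (A : algebra) : Prop :=
  forall e : equation, In e Md -> satisfies A e.

(* Main.v *)
(** In a commutative ring, an element [y] with [x x y = x] and [y y x = y] is
    determined by [x], and the two inverse axioms of [Md] say that [x^-1] is
    such an element.  Hence it suffices to see that [x^-1 y^-1] is one for
    [x y] and [-(x^-1)] is one for [-x].  The semantic half follows from the
    derivations by soundness of equational logic. *)

From Stdlib Require Import List Setoid Morphisms Ring.
Require Import Defs.

Definition md_eq (s t : term) : Prop := derivable Md (s == t).

(** The axioms of [Md] use only the variables 0, 1, 2, so three terms fix an instance. *)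
Definition assign (s t u : term) (n : nat) : term :=
  match n with O => s | S O => t | _ => u end.

Lemma Md_instance (e : equation) (s t u : term) :
  In e Md -> md_eq (subst (assign s t u) (lhs e)) (subst (assign s t u) (rhs e)).
Proof. exact (D_ax (E := Md) (e := e) (assign s t u)). Qed.

#[local] Instance md_eq_equiv : Equivalence md_eq.
Proof.
  split.
  - intro s; apply D_refl.
  - intros s t; apply D_sym.
  - intros s t u; apply D_trans.
Qed.

#[local] Instance Add_md_eq : Proper (md_eq ==> md_eq ==> md_eq) Add.
Proof. intros s s' Hs t t' Ht; apply D_add; assumption. Qed.

#[local] Instance Mul_md_eq : Proper (md_eq ==> md_eq ==> md_eq) Mul.
Proof. intros s s' Hs t t' Ht; apply D_mul; assumption. Qed.

#[local] Instance Opp_md_eq : Proper (md_eq ==> md_eq) Opp.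
Proof. intros s s' Hs; apply D_opp; assumption. Qed.

Ltac Md_axiom e s t u :=
  apply (Md_instance e s t u); simpl; tauto.

Lemma md_ring_theory :
  ring_theory Zero One Add Mul (fun s t => Add s (Opp t)) Opp md_eq.
Proof.
  (* [Md] has its units on the right and distributes from the left; [ring_theory] asks for the
     opposite sides, so commutativity comes first. *)
  assert (addC : forall s t, md_eq (s + t) (t + s)).
  { intros s t; Md_axiom (vx + vy == vy + vx) s t s. }
  assert (mulC : forall s t, md_eq (s * t) (t * s)).
  { intros s t; Md_axiom (vx * vy == vy * vx) s t s. }
  assert (mulDr : forall s t u, md_eq (s * (t + u)) (s * t + s * u)).
  { intros s t u; Md_axiom (vx * (vy + vz) == vx * vy + vx * vz) s t u. }
  split.
  - intro s; rewrite addC; Md_axiom (vx + 0 == vx) s s s.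
  - exact addC.
  - intros s t u; symmetry.
    Md_axiom ((vx + vy) + vz == vx + (vy + vz)) s t u.
  - intro s; rewrite mulC; Md_axiom (vx * 1 == vx) s s s.
  - exact mulC.
  - intros s t u; symmetry.
    Md_axiom ((vx * vy) * vz == vx * (vy * vz)) s t u.
  - intros s t u; rewrite (mulC (s + t)%term u), mulDr, (mulC u s), (mulC u t).
    reflexivity.
  - reflexivity.
  - intro s; Md_axiom (vx + - vx == 0) s s s.
Qed.

Lemma md_ring_eq_ext : ring_eq_ext Add Mul Opp md_eq.
Proof. split; [exact Add_md_eq | exact Mul_md_eq | exact Opp_md_eq]. Qed.

(* From here on [ring] proves derivability from [Md], with inverses as atoms. *)
Add Ring md_ring : md_ring_theory (setoid md_eq_equiv md_ring_eq_ext).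

Lemma md_inv_inv (s : term) : md_eq (s^-1)^-1 s.
Proof. Md_axiom ((vx^-1)^-1 == vx) s s s. Qed.

Lemma md_mul_inv (s : term) : md_eq (s * (s * s^-1)) s.
Proof. Md_axiom (vx * (vx * vx^-1) == vx) s s s. Qed.

Lemma md_inv_mul (s : term) : md_eq (s^-1 * (s^-1 * s)) (s^-1).
Proof. rewrite <- (md_inv_inv s) at 3; apply md_mul_inv. Qed.

Lemma md_inv_unique (s t : term) :
  md_eq (s * (s * t)) s -> md_eq (t * (t * s)) t -> md_eq (s^-1) t.
Proof.
  intros Hst Hts.
  (* Both sides equal [s^-1 * (s * t)]. *)
  transitivity (s^-1 * (s * t))%term.
  (* Expanding both copies of [s^-1], then the bare [s] on the left, turns both sides into the
     product of [s^-1], [s^-1], [s], [s], [t]. *)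
  - rewrite <- (md_inv_mul s) at 1 2.
    rewrite <- Hst at 3.
    ring.
  (* Likewise both sides become the product of [s^-1], [s], [s], [t], [t]. *)
  - rewrite <- Hts at 1 2.
    rewrite <- (md_mul_inv s) at 4.
    ring.
Qed.

Lemma md_invM (s t : term) : md_eq ((s * t)^-1) (s^-1 * t^-1).
Proof.
  apply md_inv_unique.
  - transitivity ((s * (s * s^-1)) * (t * (t * t^-1)))%term; [ring |].
    rewrite !md_mul_inv; reflexivity.
  - transitivity ((s^-1 * (s^-1 * s)) * (t^-1 * (t^-1 * t)))%term; [ring |].
    rewrite !md_inv_mul; reflexivity.
Qed.

Lemma md_invN (s : term) : md_eq ((- s)^-1) (- (s^-1)).
Proof.
  apply md_inv_unique.
  (* Of the three signs, two cancel. *)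
  - transitivity (- (s * (s * s^-1)))%term; [ring |].
    rewrite md_mul_inv; reflexivity.
  - transitivity (- (s^-1 * (s^-1 * s)))%term; [ring |].
    rewrite md_inv_mul; reflexivity.
Qed.

Lemma eval_subst (A : algebra) (v : nat -> A) (sigma : nat -> term) (t : term) :
  eval v (subst sigma t) = eval (fun n => eval v (sigma n)) t.
Proof. induction t; simpl; congruence. Qed.

Lemma derivable_sound (A : algebra) (E : list equation) (e : equation) :
  (forall e', In e' E -> satisfies A e') -> derivable E e -> satisfies A e.
Proof.
  unfold satisfies; intros HA He v.
  induction He; simpl in *; try congruence.
  (* Only the axiom case remains: an instance under [v] is the axiom itself under [v] composed with
     the substitution. *)
  rewrite !eval_subst; auto.
Qed.

Theorem proposition2p8 :
  (derivable Md ((vx * vy)^-1 == vx^-1 * vy^-1) /\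
   derivable Md ((- vx)^-1 == - (vx^-1)))
  /\
  (forall M : algebra, meadow M ->
     (forall x y : M, inv (mul x y) = mul (inv x) (inv y)) /\
     (forall x : M, inv (opp x) = opp (inv x))).
Proof.
  split; [split; [apply md_invM | apply md_invN] |].
  intros M HM; split.
  - intros x y.
    (* The derivation for variables is read under a valuation sending them to [x] and [y]. *)
    exact (derivable_sound M Md _ HM (md_invM vx vy)
             (fun n => match n with O => x | _ => y end)).
  - intro x.
    exact (derivable_sound M Md _ HM (md_invN vx) (fun _ => x)).
Qed.
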